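(* Let $X$, $Y$, $Z$ be metric spaces, let $F:X\rightrightarrows Y$ be a set-valued mapping and let $g:Z\to X$ be a (single-valued) mapping. Let $\bar z\in Z$ and let $(g(\bar z),\bar y)\in\mathrm{graph}\,F$. Suppose that: (i) $g$ is continuous at $\bar z$ and strongly metrically subregular at $\bar z$; (ii) $F$ is strongly metrically subregular at $(g(\bar z),\bar y)$. Then the composition $F\circ g:Z\rightrightarrows Y$ is strongly metrically subregular at $(\bar z,\bar y)$, and $$\mathrm{subreg}\,(F\circ g)(\bar z,\bar y)\le\mathrm{subreg}\,g(\bar z)\cdot\mathrm{subreg}\,F(g(\bar z),\bar y).$$
   Context: In a metric space, $B(x,r)$ denotes the closed ball with center $x$ and radius $r$, and $\mathrm{dist}(x,S)=\inf_{s\in S}d(x,s)$, with $\mathrm{dist}(x,\varnothing)=+\infty$. For a set-valued mapping $F:X\rightrightarrows Y$, $\mathrm{graph}\,F=\{(x,y): y\in F(x)\}$ and $F^{-1}(y)=\{x\in X: y\in F(x)\}$. The composition is $(F\circ g)(z)=F(g(z))$. $F$ is metrically subregular at $(\bar x,\bar y)\in\mathrm{graph}\,F$ if there exist $\kappa\ge 0$ and $r>0$ such that $$\mathrm{dist}(x,F^{-1}(\bar y))\le\kappa\,\mathrm{dist}(\bar y,F(x)),\quad\forall x\in B(\bar x,r).$$ The modulus of subregularity $\mathrm{subreg}\,F(\bar x,\bar y)$ is the infimum of all $\kappa\ge 0$ for which there exists $r>0$ such that this inequality holds. $F$ is strongly metrically subregular at $(\bar x,\bar y)$ if it is metrically subregular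 at $(\bar x,\bar y)$ and, in addition, $\bar x$ is an isolated point of $F^{-1}(\bar y)$; equivalently, if there exist $\kappa\ge0$ and $r>0$ such that $d(x,\bar x)\le\kappa\,\mathrm{dist}(\bar y,F(x))$ for all $x\in B(\bar x,r)$. A single-valued mapping $g$ is strongly metrically subregular at $\bar z$ if it is so, as a set-valued mapping $z\mapsto\{g(z)\}$, at $(\bar z,g(\bar z))$; its modulus is then written $\mathrm{subreg}\,g(\bar z)$. *)

(* Defs.v *)
From HB Require Import structures.
From mathcomp Require Import all_boot all_order all_algebra.
From mathcomp Require Import boolp classical_sets reals ereal topology.

Set Implicit Arguments.
Unset Strict Implicit.
Unset Printing Implicit Defensive.

Import Order.TTheory GRing.Theory Num.Theory.

Local Open Scope classical_set_scope.
Local Open Scope ring_scope.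

(* The library's [closed_ball] is the closure of the open ball, which in a
   general metric space can be strictly smaller than this set. *)
Definition cball (R : realType) (X : metricType R) (x : X) (r : R) : set X :=
  [set y | mdist x y <= r].

(* Extended-real valued, so that the distance to the empty set is +oo. *)
Definition dist (R : realType) (X : metricType R) (x : X) (S : set X) : \bar R :=
  ereal_inf [set (mdist x s)%:E | s in S].

(* A set-valued mapping from X to Y is a function X -> set Y. *)
Definition graph (X Y : Type) (F : X -> set Y) : set (X * Y) :=
  [set xy | F xy.1 xy.2].

Definition svinv (X Y : Type) (F : X -> set Y) (y : Y) : set X :=
  [set x | F x y].

Definition svfun (X Y : Type) (g : X -> Y) : X -> set Y :=
  fun x => [set g x].

(* In [\bar R], 0 * +oo = 0. This only affects k = 0 at points x with F x
   empty. If the inequality holds for k = 0 under either convention for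
   0 * +oo, it holds for every k > 0, so that neither subregularity nor the
   modulus depends on the convention. *)
Definition subreg_on (R : realType) (X Y : metricType R) (F : X -> set Y)
    (xbar : X) (ybar : Y) (k r : R) : Prop :=
  forall x, cball xbar r x ->
    (dist x (svinv F ybar) <= k%:E * dist ybar (F x))%E.

Definition metrically_subregular (R : realType) (X Y : metricType R)
    (F : X -> set Y) (xbar : X) (ybar : Y) : Prop :=
  graph F (xbar, ybar) /\
  exists k r : R, [/\ 0 <= k, 0 < r & subreg_on F xbar ybar k r].

Definition subreg (R : realType) (X Y : metricType R)
    (F : X -> set Y) (xbar : X) (ybar : Y) : \bar R :=
  ereal_inf [set k%:E | k in
    [set k : R | 0 <= k /\ exists2 r : R, 0 < r & subreg_on F xbar ybar k r]].

Definition strongly_subregular (R : realType) (X Y : metricType R)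
    (F : X -> set Y) (xbar : X) (ybar : Y) : Prop :=
  metrically_subregular F xbar ybar /\ isolated (svinv F ybar) xbar.

Definition strongly_subregular_fun (R : realType) (X Y : metricType R)
    (g : X -> Y) (xbar : X) : Prop :=
  strongly_subregular (svfun g) xbar (g xbar).

Definition subreg_fun (R : realType) (X Y : metricType R)
    (g : X -> Y) (xbar : X) : \bar R :=
  subreg (svfun g) xbar (g xbar).

(* Main.v *)
Require Import Defs.
From HB Require Import structures.
From mathcomp Require Import all_boot all_order all_algebra.
From mathcomp Require Import boolp classical_sets reals ereal topology.

(** Near an isolated point [xbar] of [F^-1 ybar], the nearest point of
    [F^-1 ybar] is [xbar] itself, so a subregularity constant [k] also
    satisfies the strong estimate [d(x, xbar) <= k * dist(ybar, F x)], possibly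
    on a smaller ball ([subreg_on_strong]); conversely, the strong estimate
    gives back both subregularity with the same constant ([strong_on_subreg])
    and isolation ([strong_on_isolated]).

    Strong estimates compose ([strong_on_comp]).  For [z] close to [zbar],
    continuity puts [g z] in the ball where the estimate for [F] holds, and
    then
    [d(z, zbar) <= k * d(g z, g zbar) <= k * (l * dist(ybar, F (g z)))].
    Hence [k * l] is a constant for [F \o g] whenever [k] is one for [g] and
    [l] is one for [F], and the bound on the moduli follows by taking the
    infimum over [l], then over [k] ([le_ereal_inf_mul]).  Both sets of
    constants are nonempty by hypothesis, which excludes an infimum equal to
    [+oo] and hence an undesired product [0 * +oo]. *)

Set Implicit Arguments.
Unset Strict Implicit.
Unset Printing Implicit Defensive.

Import Order.TTheory GRing.Theory Num.Theory.

Local Open Scope classical_set_scope.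
Local Open Scope ring_scope.

(** For [x > 0] multiplication by [x] commutes with infima; for [x = 0] an
    element of [A] is needed, since [ereal_inf set0] is [+oo] and
    [0 * +oo = 0]. *)
Lemma le_mul_ereal_inf (R : realType) (A : set (\bar R)) (x : R) (c : \bar R) :
  A !=set0 -> 0 <= x -> (forall a, A a -> c <= x%:E * a)%E ->
  (c <= x%:E * ereal_inf A)%E.
Proof.
move=> [a Aa]; rewrite le_eqVlt => /predU1P[<-|x0] cA.
  by rewrite mul0e -(mul0e a); exact: cA.
rewrite -ereal_inf_pZl//; apply: le_ereal_inf_tmp => _ [b Ab <-].
exact: cA.
Qed.

Lemma le_ereal_inf_mul (R : realType) (A B : set R) (c : \bar R) :
  A !=set0 -> B !=set0 -> lbound A 0 -> lbound B 0 ->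
  (forall a b, A a -> B b -> c <= (a * b)%:E)%E ->
  (c <= ereal_inf [set a%:E | a in A] * ereal_inf [set b%:E | b in B])%E.
Proof.
move=> A0 B0 Age0 Bge0 cAB.
rewrite [X in (_ * X)%E]ereal_inf_EFin//; last by exists 0.
have [a0 Aa0] := A0.
rewrite muleC; apply: le_mul_ereal_inf.
- by exists a0%:E, a0.
- exact: lb_le_inf.
move=> _ [a Aa <-].
rewrite muleC -ereal_inf_EFin//; last by exists 0.
apply: le_mul_ereal_inf.
- by have [b Bb] := B0; exists b%:E, b.
- exact: Age0.
by move=> _ [b Bb <-]; rewrite -EFinM; exact: cAB.
Qed.

Section strong_estimate.
Variable R : realType.

Lemma nbhs_cball (X : metricType R) (x : X) (A : set X) :
  nbhs x A -> exists2 r : R, 0 < r & cball x r `<=` A.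
Proof.
move=> /nbhs_ballP[e /= e0 eA]; exists (e / 2); first exact: divr_gt0.
move=> y; rewrite /cball/= => xy; apply: eA; rewrite ballEmdist/=.
by rewrite (le_lt_trans xy)// ltr_pdivrMr// ltr_pMr// ltr1n.
Qed.

Lemma cballS (X : metricType R) (x : X) (r1 r2 : R) :
  r1 <= r2 -> cball x r1 `<=` cball x r2.
Proof. by move=> r12 y; rewrite /cball/= => /le_trans; apply. Qed.

Lemma dist_le (X : metricType R) (x s : X) (S : set X) :
  S s -> (dist x S <= (mdist x s)%:E)%E.
Proof. by move=> Ss; apply: ereal_inf_lbound; exists s. Qed.

Lemma dist_ge0 (X : metricType R) (x : X) (S : set X) : (0 <= dist x S)%E.
Proof.
by apply: le_ereal_inf_tmp => _ [s _ <-]; rewrite lee_fin mdist_ge0.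
Qed.

Lemma dist_mem (X : metricType R) (x : X) (S : set X) :
  S x -> dist x S = 0%E.
Proof.
move=> Sx; apply/eqP; rewrite eq_le dist_ge0 andbT.
by rewrite (le_trans (dist_le _ Sx))// mdistxx.
Qed.

Lemma dist_set1 (X : metricType R) (x y : X) :
  dist x [set y] = (mdist x y)%:E.
Proof. by rewrite /dist image_set1 ereal_inf1. Qed.

(** If the ball of radius [2 * e] around [xbar] contains no other point of
    [S], then a point within [e] of [xbar] is at distance at least [e] from
    every point of [S] other than [xbar]. *)
Lemma isolated_mdist_le_dist (X : metricType R) (S : set X) (xbar : X) :
  isolated S xbar ->
  exists2 e : R, 0 < e &
    forall x, cball xbar e x -> ((mdist x xbar)%:E <= dist x S)%E.
Proof.
move=> [_ [V /nbhs_cball[e e0 eV] VS]].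
exists (e / 2); first exact: divr_gt0.
move=> x; rewrite /cball/= => xe.
apply: le_ereal_inf_tmp => _ [s Ss <-]; rewrite lee_fin.
have [se|es] := leP (mdist xbar s) e.
  have : (V `&` S) s by split => //; exact: eV.
  by rewrite VS => ->.
rewrite metric_sym (le_trans xe)// -(lerD2l (e / 2)) -splitr.
rewrite (le_trans (ltW es))// (le_trans (metric_triangle _ x _))//.
by rewrite lerD2r.
Qed.

Section setvalued.
Variables (X Y : metricType R) (F : X -> set Y) (xbar : X) (ybar : Y).

Definition strong_on (k r : R) : Prop :=
  forall x, cball xbar r x ->
    ((mdist x xbar)%:E <= k%:E * dist ybar (F x))%E.

Lemma subreg_on_strong (k r : R) :
  isolated (svinv F ybar) xbar -> 0 < r -> subreg_on F xbar ybar k r ->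
  exists2 r', 0 < r' & strong_on k r'.
Proof.
move=> /isolated_mdist_le_dist[e e0 he] r0 hF.
exists (Order.min e r); first by rewrite lt_min e0.
move=> x hx; apply: (le_trans (he x _) (hF x _)); apply: cballS hx.
- by rewrite ge_min lexx.
- by rewrite ge_min lexx orbT.
Qed.

Hypothesis Fxy : graph F (xbar, ybar).

Lemma strong_on_subreg (k r : R) :
  strong_on k r -> subreg_on F xbar ybar k r.
Proof. by move=> hF x /hF; apply: le_trans; exact: dist_le. Qed.

(** At a point [x] of [F^-1 ybar] the right-hand side of the estimate
    vanishes, which forces [x = xbar]. *)
Lemma strong_on_isolated (k r : R) :
  0 < r -> strong_on k r -> isolated (svinv F ybar) xbar.
Proof.
move=> r0 hF; split; first exact/mem_set.
exists (ball xbar r); first exact: nbhsx_ballx.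
apply/seteqP; split => [x [xr Fx]|_ ->]; last first.
  by split=> //; exact: ballxx.
move: xr; rewrite ballEmdist/= => /ltW/hF.
rewrite (dist_mem (Fx : F x ybar)) mule0 lee_fin => xx.
by apply/mdist_positivity/eqP; rewrite eq_le xx mdist_ge0.
Qed.

Lemma strong_on_strongly_subregular (k r : R) :
  0 <= k -> 0 < r -> strong_on k r -> strongly_subregular F xbar ybar.
Proof.
move=> k0 r0 hF; split; last exact: strong_on_isolated hF.
by split=> //; exists k, r; split=> //; exact: strong_on_subreg.
Qed.

End setvalued.

Lemma strong_on_comp (X Y Z : metricType R) (F : X -> set Y) (g : Z -> X)
    (zbar : Z) (ybar : Y) (k l r s : R) :
  {for zbar, continuous g} -> 0 <= k -> 0 < r -> 0 < s ->
  strong_on (svfun g) zbar (g zbar) k r -> strong_on F (g zbar) ybar l s ->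
  exists2 t, 0 < t & strong_on (F \o g) zbar ybar (k * l) t.
Proof.
move=> gc k0 r0 s0 hg hF.
have /nbhs_cball[e e0 he] : nbhs zbar (g @^-1` cball (g zbar) s).
  exact: metricType_numDomainType.cvgr_dist_le gc _ s0.
exists (Order.min e r); first by rewrite lt_min e0.
move=> z hz.
have zr : cball zbar r z by apply: cballS hz; rewrite ge_min lexx orbT.
have ze : cball zbar e z by apply: cballS hz; rewrite ge_min lexx.
apply: (le_trans (hg z zr)); rewrite dist_set1 EFinM -muleA.
apply: lee_wpmul2l; first by rewrite lee_fin.
by rewrite metric_sym; exact/hF/he.
Qed.

End strong_estimate.

Theorem theorem2 (R : realType) (X Y Z : metricType R)
    (F : X -> set Y) (g : Z -> X) (zbar : Z) (ybar : Y)
    (hgraph : graph F (g zbar, ybar))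
    (hgcont : {for zbar, continuous g})
    (hgsub : strongly_subregular_fun g zbar)
    (hFsub : strongly_subregular F (g zbar) ybar) :
  strongly_subregular (F \o g) zbar ybar /\
  (subreg (F \o g) zbar ybar <= subreg_fun g zbar * subreg F (g zbar) ybar)%E.
Proof.
have [[_ [k [r [k0 r0 hg]]]] isog] := hgsub.
have [[_ [l [s [l0 s0 hF]]]] isoF] := hFsub.
have strong_comp k' r' l' s' : 0 <= k' -> 0 < r' -> 0 < s' ->
    subreg_on (svfun g) zbar (g zbar) k' r' ->
    subreg_on F (g zbar) ybar l' s' ->
    exists2 t, 0 < t & strong_on (F \o g) zbar ybar (k' * l') t.
  move=> k'0 r'0 s'0 /(subreg_on_strong isog r'0)[r1 r10 hg1].
  move=> /(subreg_on_strong isoF s'0)[s1 s10 hF1].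
  exact: (strong_on_comp hgcont k'0 r10 s10 hg1 hF1).
split.
  have [t t0 ht] := strong_comp _ _ _ _ k0 r0 s0 hg hF.
  exact: (strong_on_strongly_subregular _ (mulr_ge0 k0 l0) t0 ht).
apply: le_ereal_inf_mul.
- by exists k; split=> //; exists r.
- by exists l; split=> //; exists s.
- by move=> ? [].
- by move=> ? [].
move=> k' l' [k'0 [r' r'0 hg']] [l'0 [s' s'0 hF']].
have [t t0 ht] := strong_comp _ _ _ _ k'0 r'0 s'0 hg' hF'.
apply: ereal_inf_lbound; exists (k' * l') => //.
split; first exact: mulr_ge0.
by exists t => //; exact: strong_on_subreg.
Qed.
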